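(* Let $B_t=B_t^{(1)}+iB_t^{(2)}$ be a (one-dimensional) complex $G$-Brownian motion, write $\overrightarrow{B_t}=(B_t^{(1)},B_t^{(2)})$, and let $G(A)=\frac12\hat{\mathbb E}[\overrightarrow{B_1}A\overrightarrow{B_1}^{T}]$ for real symmetric $2\times2$ matrices $A$. Then $B$ is a conformal $G$-Brownian motion if and only if there exist $0\le\underline\sigma^2\le\bar\sigma^2<\infty$ such that for all symmetric $A$ $$G(A)=\frac12\sup_{\Lambda\in\Sigma}(A,\Lambda),\qquad \Sigma=\left\{\begin{pmatrix}\sigma^2&0\\0&\sigma^2\end{pmatrix}:\ \sigma^2\in[\underline\sigma^2,\bar\sigma^2]\right\}.$$
   Context: $(A,\Lambda)=\mathrm{tr}(A\Lambda)$. Real and complex sublinear expectation. A sublinear expectation space $(\Omega,\mathcal H,\hat{\mathbb E})$ is a set $\Omega$, a vector lattice $\mathcal H$ of real functions on $\Omega$ containing the constants and closed under $(X_1,\dots,X_n)\mapsto\varphi(X_1,\dots,X_n)$ for $\varphi\in C_{l.lip}(\mathbb R^n)$, and a functional $\hat{\mathbb E}:\mathcal H\to\mathbb R$ that is monotone, sub-additive, positively homogeneous, with $\hat{\mathbb E}[c]=c$ and $\hat{\mathbb E}[X+c]=\hat{\mathbb E}[X]+c$ for constants $c$. Put $\mathcal H_{\mathbb C}=\{X+iY: X,Y\in\mathcal H\}$ and $\hat{\mathbb E}_{\mathbb C}[X+iY]=\hat{\mathbb E}[X]+i\hat{\mathbb E}[Y]$. $C_{l.lip}(\mathbb R^n)$: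 functions with $|\varphi(x)-\varphi(y)|\le C(1+|x|^k+|y|^k)|x-y|$ for some $C,k$; $C_{l.lip}(\mathbb C^n)$: complex-valued functions on $\mathbb C^n\cong\mathbb R^{2n}$ with the same property. $Z_1\overset d=Z_2$ means $\hat{\mathbb E}_{\mathbb C}[\varphi(Z_1)]=\hat{\mathbb E}_{\mathbb C}[\varphi(Z_2)]$ for all $\varphi\in C_{l.lip}$; $Z_2$ is independent of $Z_1$ if $\hat{\mathbb E}_{\mathbb C}[\varphi(Z_1,Z_2)]=\hat{\mathbb E}_{\mathbb C}[\hat{\mathbb E}_{\mathbb C}[\varphi(z,Z_2)]_{z=Z_1}]$ for all $\varphi\in C_{l.lip}$. $Z$ is complex $G$-normal if $aZ+b\hat Z\overset d=\sqrt{a^2+b^2}\,Z$ for all $a,b\ge0$, $\hat Z$ an independent copy of $Z$ ($\hat Z\overset d=Z$, $\hat Z$ independent of $Z$). Complex $G$-Brownian motion: a process $(B_t)_{t\ge0}$ with $B_0=0$, such that for $s,t\ge0$ the increment $B_{t+s}-B_t$ is complex $G$-normal, distributed as $\sqrt s\,B_1$, and independent of $(B_{t_1},\dots,B_{t_n})$ for all $n$ and $0\le t_1\le\dots\le t_n\le t$. $L_G^2(\Omega_t)_{\mathbb C}$ is the completion of $\{\varphi(B_{t_1\wedge t},\dots,B_{t_n\wedge t}):n\in\mathbb{N},\ t_j\ge0,\ \varphi\in C_{l.lip}(\mathbb C^n)\}$ under $(\hat{\mathbb E}[|\cdot|^2])^{1/2}$. The quadratic variation $\langle B\rangle_t$ is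 the limit in this space of $\sum_j(B_{t_{j+1}}-B_{t_j})^2$ over partitions $0=t_0<\dots<t_N=t$ as the mesh tends to $0$; it equals $\langle B^{(1)}\rangle_t-\langle B^{(2)}\rangle_t+2i\langle B^{(1)},B^{(2)}\rangle_t$. $B$ is called a conformal $G$-Brownian motion if $\langle B\rangle_t=0$ in $L_G^2(\Omega_t)_{\mathbb C}$ for every $t\ge0$. *)

(* Defs.v *)
From HB Require Import structures.
From mathcomp Require Import all_boot all_order all_algebra.
From mathcomp Require Import ring lra.
From mathcomp Require Import complex.
From mathcomp Require Import all_classical all_reals topology normedtype sequences.

Set Implicit Arguments.
Unset Strict Implicit.
Unset Printing Implicit Defensive.

Import Order.TTheory GRing.Theory Num.Theory.
Import numFieldNormedType.Exports.

Local Open Scope classical_set_scope.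
Local Open Scope complex_scope.
Local Open Scope ring_scope.

(* The modulus of a complex number as an element of [R] (the norm [`|z|] of
   [R[i]] takes its values in [R[i]]). *)
Definition cabs (R : rcfType) (z : R[i]) : R := ComplexField.Normc.normc z.

Section LocallyLipschitz.
Variable R : realType.

(* Euclidean norms; the canonical norm on matrices is the sup norm. *)
Definition enorm n (x : 'rV[R]_n) : R :=
  Num.sqrt (\sum_(i < n) x ord0 i ^+ 2).

Definition cenorm n (z : 'rV[R[i]]_n) : R :=
  Num.sqrt (\sum_(i < n) cabs (z ord0 i) ^+ 2).

Definition Cllip n (phi : 'rV[R]_n -> R) : Prop :=
  exists (C : R) (k : nat), forall x y : 'rV[R]_n,
    `|phi x - phi y| <= C * (1 + enorm x ^+ k + enorm y ^+ k) * enorm (x - y).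

Definition CllipC n (phi : 'rV[R[i]]_n -> R[i]) : Prop :=
  exists (C : R) (k : nat), forall x y : 'rV[R[i]]_n,
    cabs (phi x - phi y)
      <= C * (1 + cenorm x ^+ k + cenorm y ^+ k) * cenorm (x - y).

End LocallyLipschitz.

(* [expect] is a total function on [Omega -> R], but only its values on the
   domain [rv] are constrained. *)
Record sublinear_space (R : realType) := SublinearSpace {
  Omega : Type;
  rv : set (Omega -> R);
  expect : (Omega -> R) -> R;
  rv_cst : forall c : R, rv (fun=> c);
  rv_add : forall X Y, rv X -> rv Y -> rv (fun w => X w + Y w);
  rv_scale : forall (a : R) X, rv X -> rv (fun w => a * X w);
  rv_max : forall X Y, rv X -> rv Y -> rv (fun w => Num.max (X w) (Y w));
  rv_Cllip : forall n (phi : 'rV[R]_n -> R) (X : 'I_n -> Omega -> R),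
    Cllip phi -> (forall i, rv (X i)) ->
    rv (fun w => phi (\row_(i < n) X i w));
  expect_le : forall X Y, rv X -> rv Y -> (forall w, X w <= Y w) ->
    expect X <= expect Y;
  expect_cst : forall c : R, expect (fun=> c) = c;
  expect_subadd : forall X Y, rv X -> rv Y ->
    expect (fun w => X w + Y w) <= expect X + expect Y;
  expect_poshom : forall (a : R) X, 0 <= a -> rv X ->
    expect (fun w => a * X w) = a * expect X;
  expect_addcst : forall X (c : R), rv X ->
    expect (fun w => X w + c) = expect X + c
}.

Section ComplexGBrownianMotion.
Variables (R : realType) (S : sublinear_space R).
Local Notation C := R[i].
Local Notation Om := (Omega S).

Definition crv (Z : Om -> C) : Prop :=
  rv (fun w => complex.Re (Z w)) /\ rv (fun w => complex.Im (Z w)).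

Definition cexpect (Z : Om -> C) : C :=
  expect (fun w => complex.Re (Z w)) +i* expect (fun w => complex.Im (Z w)).

Definition eqdist n (Z1 Z2 : Om -> 'rV[C]_n) : Prop :=
  forall phi : 'rV[C]_n -> C, CllipC phi ->
    cexpect (fun w => phi (Z1 w)) = cexpect (fun w => phi (Z2 w)).

(* [indep Z1 Z2] reads "[Z2] is independent of [Z1]"; the relation is not
   symmetric. *)
Definition indep m n (Z1 : Om -> 'rV[C]_m) (Z2 : Om -> 'rV[C]_n) : Prop :=
  forall phi : 'rV[C]_(m + n) -> C, CllipC phi ->
    cexpect (fun w => phi (row_mx (Z1 w) (Z2 w))) =
    cexpect (fun w => cexpect (fun w' => phi (row_mx (Z1 w) (Z2 w')))).

Definition vec1 (Z : Om -> C) : Om -> 'rV[C]_1 := fun w => const_mx (Z w).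

Definition indep_copy (Z Zhat : Om -> C) : Prop :=
  [/\ crv Zhat, eqdist (vec1 Zhat) (vec1 Z) & indep (vec1 Z) (vec1 Zhat)].

(* The existence of an independent copy is part of the definition, so that it
   cannot hold vacuously; the law of [a Z + b Zhat] does not depend on the
   copy. *)
Definition complex_Gnormal (Z : Om -> C) : Prop :=
  crv Z /\
  exists2 Zhat, indep_copy Z Zhat &
    forall a b : R, 0 <= a -> 0 <= b ->
      eqdist (vec1 (fun w => a%:C * Z w + b%:C * Zhat w))
             (vec1 (fun w => (Num.sqrt (a ^+ 2 + b ^+ 2))%:C * Z w)).

(* A process is indexed by [R]; only its values at nonnegative times matter. *)
Definition complex_GBM (B : R -> Om -> C) : Prop :=
  [/\ forall t, 0 <= t -> crv (B t),
      forall w, B 0 w = 0 &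
      forall t s : R, 0 <= t -> 0 <= s ->
        let dB := fun w => B (t + s) w - B t w in
        [/\ complex_Gnormal dB,
            eqdist (vec1 dB) (vec1 (fun w => (Num.sqrt s)%:C * B 1 w)) &
            forall n (ts : 'I_n -> R),
              (forall i, 0 <= ts i <= t) ->
              (forall i j : 'I_n, (i <= j)%N -> ts i <= ts j) ->
              indep (fun w => \row_(i < n) B (ts i) w) (vec1 dB)]].

Definition L2norm (X : Om -> C) : R :=
  Num.sqrt (expect (fun w => cabs (X w) ^+ 2)).

Definition cylinder (B : R -> Om -> C) (t : R) (X : Om -> C) : Prop :=
  exists n (ts : 'I_n -> R) (phi : 'rV[C]_n -> C),
    [/\ forall i, 0 <= ts i, CllipC phi &
        X = fun w => phi (\row_(i < n) B (Num.min (ts i) t) w)].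

(* The completion of the cylinder functions for [L2norm]: its elements are
   represented by Cauchy sequences, two of them being identified when
   [L2dist] between them vanishes. *)
Record L2G (B : R -> Om -> C) (t : R) := MkL2G {
  L2seq :> nat -> Om -> C;
  L2seq_cylinder : forall n, cylinder B t (L2seq n);
  L2seq_cauchy : forall e : R, 0 < e -> exists N : nat, forall m n : nat,
    (N <= m)%N -> (N <= n)%N -> L2norm (fun w => L2seq m w - L2seq n w) < e
}.

Definition L2dist B t (p q : L2G B t) : R :=
  limn (fun n => L2norm (fun w => p n w - q n w)).

Lemma L2norm0 : L2norm (fun=> 0) = 0.
Proof.
rewrite /L2norm; set f := fun w => _.
have -> : f = fun=> 0.
  by apply/funext => w; rewrite /f /cabs ComplexField.Normc.normc0 expr0n.
by rewrite expect_cst sqrtr0.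
Qed.

Lemma cst_L2_cauchy (X : Om -> C) (e : R) : 0 < e ->
  exists N : nat, forall m n : nat, (N <= m)%N -> (N <= n)%N ->
    L2norm (fun w => X w - X w) < e.
Proof.
move=> e0; exists 0%N => m n _ _.
have -> : (fun w => X w - X w) = fun=> 0 by apply/funext => w; rewrite subrr.
by rewrite L2norm0.
Qed.

Definition L2embed B t (X : Om -> C) (hX : cylinder B t X) : L2G B t :=
  @MkL2G B t (fun=> X) (fun=> hX) (@cst_L2_cauchy X).

Lemma cylinder0 B t : cylinder B t (fun=> 0).
Proof.
exists 0%N, (fun=> 0), (fun=> 0); split=> //; exists 0, 0%N => x y.
by rewrite subrr /cabs ComplexField.Normc.normc0 !mul0r.
Qed.

Definition L2zero B t : L2G B t := L2embed (cylinder0 B t).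

Definition is_partition (t : R) (N : nat) (pi : nat -> R) : Prop :=
  [/\ pi 0%N = 0, pi N = t & forall j, (j < N)%N -> pi j < pi j.+1].

Definition qv_sum (B : R -> Om -> C) (N : nat) (pi : nat -> R) : Om -> C :=
  fun w => \sum_(j < N) (B (pi j.+1) w - B (pi j) w) ^+ 2.

Lemma cabsD (x y : C) : cabs (x + y) <= cabs x + cabs y.
Proof. exact: le_normcD. Qed.

Lemma cabsB (x y : C) : cabs (x - y) <= cabs x + cabs y.
Proof. by rewrite -[cabs y]normcN; exact: le_normcD. Qed.

Lemma cabs_coord n (x : 'rV[C]_n) i : cabs (x ord0 i) <= cenorm x.
Proof.
have c0 : 0 <= cabs (x ord0 i) by rewrite /cabs; case: (x _ _) => a b; exact: sqrtr_ge0.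
rewrite -[leLHS]ger0_norm// -sqrtr_sqr ler_wsqrtr// (bigD1 i)//= lerDl.
by apply: sumr_ge0 => j _; exact: sqr_ge0.
Qed.

Lemma CllipC_qv N : CllipC (fun x : 'rV[C]_N.+1 =>
  \sum_(j < N) (x ord0 (lift ord0 j) - x ord0 (widen_ord (leqnSn N) j)) ^+ 2).
Proof.
exists (4 * N%:R), 1%N => x y; rewrite -sumrB.
have cabs_sum (F : 'I_N -> C) : cabs (\sum_(j < N) F j) <= \sum_(j < N) cabs (F j).
  elim/big_ind2: _ => [|a b c d ab cd|//].
    by rewrite /cabs ComplexField.Normc.normc0.
  by apply: le_trans (cabsD _ _) _; exact: lerD.
apply: le_trans (cabs_sum _) _; rewrite !expr1.
have -> : 4 * N%:R * (1 + cenorm x + cenorm y) * cenorm (x - y) =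
    \sum_(j < N) 4 * ((1 + cenorm x + cenorm y) * cenorm (x - y)).
  by rewrite sumr_const card_ord -mulr_natl; ring.
apply: ler_sum => j _; rewrite subr_sqr /cabs ComplexField.Normc.normcM -/(cabs _) -/(cabs _).
set u := lift ord0 j; set v := widen_ord _ j.
have h1 : cabs (x ord0 u - x ord0 v - (y ord0 u - y ord0 v)) <= 2 * cenorm (x - y).
  have -> : x ord0 u - x ord0 v - (y ord0 u - y ord0 v) =
      (x - y) ord0 u - (x - y) ord0 v by rewrite !mxE; ring.
  apply: le_trans (cabsB _ _) _; rewrite mulr_natl mulr2n.
  by apply: lerD; exact: cabs_coord.
have h2 : cabs (x ord0 u - x ord0 v + (y ord0 u - y ord0 v)) <=
    2 * (1 + cenorm x + cenorm y).
  apply: le_trans (cabsD _ _) _.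
  have := lerD (cabs_coord x u) (cabs_coord x v).
  have := lerD (cabs_coord y u) (cabs_coord y v).
  have := cabsB (x ord0 u) (x ord0 v); have := cabsB (y ord0 u) (y ord0 v); lra.
have -> : 4 * ((1 + cenorm x + cenorm y) * cenorm (x - y)) =
    (2 * cenorm (x - y)) * (2 * (1 + cenorm x + cenorm y)) by ring.
have cabs_ge0 (z : C) : 0 <= cabs z by rewrite /cabs; case: z => a b; exact: sqrtr_ge0.
by apply: ler_pM.
Qed.

Lemma partition_bounds (t : R) N pi : is_partition t N pi ->
  forall j, (j <= N)%N -> 0 <= pi j <= t.
Proof.
case=> pi0 piN lt_pi j jN.
have mono k i : (i + k <= N)%N -> pi i <= pi (i + k)%N.
  elim: k => [|k IH]; first by rewrite addn0.
  by rewrite addnS => ikN; exact: le_trans (IH (ltnW ikN)) (ltW (lt_pi _ ikN)).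
rewrite -pi0 -piN (mono j 0%N)//=.
by have := @mono (N - j)%N j; rewrite subnKC//; apply.
Qed.

Lemma cylinder_qv_sum B t N pi : is_partition t N pi ->
  cylinder B t (qv_sum B N pi).
Proof.
move=> hpi; have hb := partition_bounds hpi.
exists N.+1, (fun i : 'I_N.+1 => pi i), (fun x : 'rV[C]_N.+1 =>
  \sum_(j < N) (x ord0 (lift ord0 j) - x ord0 (widen_ord (leqnSn N) j)) ^+ 2).
split; [by move=> i; case/andP: (hb i (ltn_ord i)) | exact: CllipC_qv |].
apply/funext => w; apply: eq_bigr => j _; rewrite !mxE /=.
case/andP: (hb j (ltnW (ltn_ord j))) => _ /min_idPl ->.
by case/andP: (hb j.+1 (ltn_ord j)) => _ /min_idPl ->.
Qed.

Definition is_quadratic_variation B t (q : L2G B t) : Prop :=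
  forall e : R, 0 < e -> exists2 d : R, 0 < d &
    forall N pi (hpi : is_partition t N pi),
      (forall j, (j < N)%N -> pi j.+1 - pi j < d) ->
      L2dist (L2embed (cylinder_qv_sum B hpi)) q < e.

Definition conformal_GBM (B : R -> Om -> C) : Prop :=
  complex_GBM B /\
  forall t, 0 <= t -> exists2 q : L2G B t,
    is_quadratic_variation q & L2dist q (L2zero B t) = 0.

Definition rvec (z : C) : 'rV[R]_2 :=
  \row_(j < 2) if j == ord0 then complex.Re z else complex.Im z.

Definition Gfun (B : R -> Om -> C) (A : 'M[R]_2) : R :=
  2^-1 * expect (fun w => (rvec (B 1 w) *m A *m (rvec (B 1 w))^T) ord0 ord0).

End ComplexGBrownianMotion.

(* [lo], [hi] and [v] are variances: they stand for squares, and are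
   nonnegative as soon as [0 <= lo]. *)
Definition conformal_Sigma (R : realType) (lo hi : R) : set 'M[R]_2 :=
  [set v%:M | v in [set v : R | lo <= v <= hi]].

(* Main.v *)
Require Import Defs.
From mathcomp Require Import all_boot all_order all_algebra.
From mathcomp Require Import ring lra.
From mathcomp Require Import complex.
From mathcomp Require Import all_classical all_reals topology normedtype sequences.

(** Write [Z = B 1].  Both sides of the equivalence say that the random
    variable [Z ^+ 2] has mean zero, without mean uncertainty, in every
    direction of the complex plane: [expect (Re (c * Z ^+ 2)) = 0] for every
    complex number [c].

    On the side of [G], a quadratic form with matrix [A] evaluated at [Z] is
    [\tr A / 2 * |Z|^2 + Re (c * Z ^+ 2)] where [c] is determined by the
    trace-free part of [A] ([quad_rvec]).  A summand without mean uncertainty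
    can be dropped ([expect_add_zero_mean]), so that [2 * G A] is the sublinear
    expectation of [\tr A / 2 * |Z|^2], which is [hi * \tr A] or [lo * \tr A]
    according to the sign of the trace, [2 * hi] and [2 * lo] being the upper
    and lower means of [|Z|^2].  This is the supremum of [v * \tr A] over
    [lo <= v <= hi] ([sup_conformal_Sigma]).  Conversely, such a formula
    vanishes on trace-free matrices, which yield all the numbers [c].

    On the side of the quadratic variation ([conformal_GBMP]), integrating
    the increments one by one from the last ([expect_qv_sum_last]) gives
    [expect (Re (c * q)) = t * expect (Re (c * Z ^+ 2))] for the sum [q] of
    the squared increments along any partition of [[0, t]]
    ([expect_Re_qv_sum]).  If the quadratic variation is zero, [q] tends to
    zero in L2, which forces the right-hand side to be nonpositive, hence zero
    because [- c] is also allowed.  Conversely, if [Z ^+ 2] has mean zero in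
    all directions, the cross terms of [|q|^2] integrate to zero, and
    [expect |q|^2] is bounded by the mesh times [t * expect |Z|^4]
    ([expect_sqr_qv_sum_le]); thus the quadratic variation exists and is zero.

    The distance of the completion being a limit of norms, its use rests on
    Minkowski's inequality for a sublinear expectation ([L2norm_triangle]); the
    integrability of all the expressions above comes from the fact that
    complex functions of locally Lipschitz type form an algebra
    ([CllipC_mul]) and preserve random variables ([crv_CllipC]). *)

Set Implicit Arguments.
Unset Strict Implicit.
Unset Printing Implicit Defensive.

Import Order.TTheory GRing.Theory Num.Theory.
Import numFieldNormedType.Exports.

Local Open Scope classical_set_scope.
Local Open Scope complex_scope.
Local Open Scope ring_scope.

(** * The modulus of complex numbers and rows *)

Section Modulus.
Variable R : realType.
Local Notation C := R[i].
Implicit Types z : C.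

Lemma cabs_ge0 z : 0 <= cabs z.
Proof. by case: z => a b; exact: sqrtr_ge0. Qed.

Lemma cabs0 : cabs (0 : C) = 0.
Proof. exact: ComplexField.Normc.normc0. Qed.

Lemma cabsM z1 z2 : cabs (z1 * z2) = cabs z1 * cabs z2.
Proof. exact: ComplexField.Normc.normcM. Qed.

Lemma sqr_cabs z : cabs z ^+ 2 = complex.Re z ^+ 2 + complex.Im z ^+ 2.
Proof. by case: z => a b; rewrite sqr_sqrtr// addr_ge0// sqr_ge0. Qed.

Lemma cabs_conj z : cabs z^* = cabs z.
Proof. by case: z => a b; rewrite /cabs /= sqrrN. Qed.

Lemma normRe_le_cabs z : `|complex.Re z| <= cabs z.
Proof.
by rewrite -sqrtr_sqr -[leRHS]ger0_norm ?cabs_ge0// -sqrtr_sqr ler_wsqrtr//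
  sqr_cabs lerDl sqr_ge0.
Qed.

Lemma normIm_le_cabs z : `|complex.Im z| <= cabs z.
Proof.
by rewrite -sqrtr_sqr -[leRHS]ger0_norm ?cabs_ge0// -sqrtr_sqr ler_wsqrtr//
  sqr_cabs lerDr sqr_ge0.
Qed.

Lemma Re_conj z : complex.Re z^* = complex.Re z.
Proof. by case: z. Qed.

Lemma Im_conj z : complex.Im z^* = - complex.Im z.
Proof. by case: z. Qed.

Lemma cenorm_ge0 n (x : 'rV[C]_n) : 0 <= cenorm x.
Proof. exact: sqrtr_ge0. Qed.

Lemma cenorm0 n : cenorm (0 : 'rV[C]_n) = 0.
Proof.
rewrite /cenorm big1 ?sqrtr0// => i _.
by rewrite mxE cabs0 expr0n.
Qed.

Lemma cabs_coordB n (x y : 'rV[C]_n) i :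
  cabs (x ord0 i - y ord0 i) <= cenorm (x - y).
Proof. by have := cabs_coord (x - y) i; rewrite !mxE. Qed.

End Modulus.

(** * The algebra of locally Lipschitz functions *)

Section LocallyLipschitzAlgebra.
Variables (R : realType) (n : nat).
Local Notation C := R[i].
Implicit Types (f g : 'rV[C]_n -> C).

(** A power of [1 + |x| + |y|] is comparable, up to a factor, with the sum of
    the powers; this form of the weight is multiplicative in the exponent,
    hence convenient for sums and products. *)
Lemma CllipCP f : CllipC f <-> exists (c : R) (k : nat), 0 <= c /\
  forall x y, cabs (f x - f y) <=
    c * (1 + cenorm x + cenorm y) ^+ k * cenorm (x - y).
Proof.
split=> [[c [k fP]]|[c [k [c0 fP]]]].
  exists (`|c| * 3), k; split=> [|x y]; first by rewrite mulr_ge0.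
  apply: le_trans (fP x y) _; apply: ler_wpM2r; first exact: cenorm_ge0.
  have x0 := cenorm_ge0 x; have y0 := cenorm_ge0 y.
  set M := 1 + cenorm x + cenorm y.
  have [h1 h2 h3] : [/\ 1 <= M, cenorm x <= M & cenorm y <= M].
    by rewrite /M; split; lra.
  have hx : cenorm x ^+ k <= M ^+ k by rewrite lerXn2r ?nnegrE//; lra.
  have hy : cenorm y ^+ k <= M ^+ k by rewrite lerXn2r ?nnegrE//; lra.
  have h : 1 <= M ^+ k by exact: exprn_ege1.
  rewrite -mulrA; apply: (@le_trans _ _ (`|c| * (1 + cenorm x ^+ k + cenorm y ^+ k))).
    apply: ler_wpM2r; last exact: ler_norm.
    by rewrite !addr_ge0// exprn_ge0.
  by apply: ler_wpM2l => //; lra.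
exists (c * 3 ^+ k), k => x y.
apply: le_trans (fP x y) _; apply: ler_wpM2r; first exact: cenorm_ge0.
rewrite -mulrA; apply: ler_wpM2l => //.
have := cenorm_ge0 x; have := cenorm_ge0 y.
move: (cenorm x) (cenorm y) => a b b0 a0.
have h (m : R) : 0 <= m -> 1 + a + b <= 3 * m -> m ^+ k <= 1 + a ^+ k + b ^+ k ->
    (1 + a + b) ^+ k <= 3 ^+ k * (1 + a ^+ k + b ^+ k).
  move=> m0 hm hk; apply: (@le_trans _ _ ((3 * m) ^+ k)).
    by rewrite lerXn2r ?nnegrE//; lra.
  by rewrite exprMn; apply: ler_wpM2l => //; exact: exprn_ge0.
have ak : 0 <= a ^+ k by exact: exprn_ge0.
have bk : 0 <= b ^+ k by exact: exprn_ge0.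
have [ab|ba] := leP a b.
  by have [b1|b1] := leP b 1; [apply: (h 1); rewrite ?expr1n | apply: (h b)]; lra.
by have [a1|a1] := leP a 1; [apply: (h 1); rewrite ?expr1n | apply: (h a)]; lra.
Qed.

Lemma CllipC_growth f : CllipC f -> exists (c : R) (k : nat), 0 <= c /\
  forall x, cabs (f x) <= c * (1 + cenorm x) ^+ k.
Proof.
move=> /CllipCP[c [k [c0 fP]]]; exists (cabs (f 0) + c), k.+1.
split=> [|x]; first by rewrite addr_ge0 ?cabs_ge0.
have x0 := cenorm_ge0 x.
have := fP x 0; rewrite cenorm0 addr0 subr0 => h.
have -> : f x = f 0 + (f x - f 0) by ring.
apply: le_trans (cabsD _ _) _; rewrite mulrDl; apply: lerD.
  by rewrite ler_peMr ?cabs_ge0// exprn_ege1; lra.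
apply: le_trans h _; rewrite exprSr mulrA; apply: ler_wpM2l; last by lra.
by rewrite mulr_ge0// exprn_ge0//; lra.
Qed.

Lemma CllipC_cst c : CllipC (fun _ : 'rV[C]_n => c).
Proof. by exists 0, 0%N => x y; rewrite subrr cabs0 !mul0r. Qed.

Lemma CllipC_coord i : CllipC (fun x : 'rV[C]_n => x ord0 i).
Proof.
apply/CllipCP; exists 1, 0%N; split=> // x y.
by rewrite expr0 !mul1r cabs_coordB.
Qed.

Lemma CllipC_conj f : CllipC f -> CllipC (fun x => (f x)^*).
Proof.
move=> [c [k fP]]; exists c, k => x y.
by rewrite -rmorphB cabs_conj.
Qed.

Lemma CllipC_add f g : CllipC f -> CllipC g -> CllipC (fun x => f x + g x).
Proof.
move=> /CllipCP[c [k [c0 fP]]] /CllipCP[d [l [d0 gP]]].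
apply/CllipCP; exists (c + d), (k + l)%N; split=> [|x y]; first exact: addr_ge0.
have -> : f x + g x - (f y + g y) = (f x - f y) + (g x - g y) by ring.
apply: le_trans (cabsD _ _) _; rewrite 2!mulrDl.
have x0 := cenorm_ge0 x; have y0 := cenorm_ge0 y.
have M1 : 1 <= 1 + cenorm x + cenorm y by lra.
apply: lerD.
  apply: le_trans (fP x y) _; apply: ler_wpM2r; first exact: cenorm_ge0.
  by apply: ler_wpM2l => //; apply: ler_weXn2l => //; exact: leq_addr.
apply: le_trans (gP x y) _; apply: ler_wpM2r; first exact: cenorm_ge0.
by apply: ler_wpM2l => //; apply: ler_weXn2l => //; exact: leq_addl.
Qed.

(** The Leibniz decomposition of the difference of two products leaves one
    bare factor, whose polynomial growth is absorbed in the exponent: this is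
    what makes the local Lipschitz class, unlike the Lipschitz one, an
    algebra. *)
Lemma CllipC_mul f g : CllipC f -> CllipC g -> CllipC (fun x => f x * g x).
Proof.
move=> fL gL.
have [c' [k' [c'0 fG]]] := CllipC_growth fL.
have [d' [l' [d'0 gG]]] := CllipC_growth gL.
move: fL gL => /CllipCP[c [k [c0 fP]]] /CllipCP[d [l [d0 gP]]].
apply/CllipCP; exists (c' * d + c * d'), (k' + l + (k + l'))%N.
split=> [|x y]; first by rewrite addr_ge0// mulr_ge0.
have -> : f x * g x - f y * g y = f x * (g x - g y) + (f x - f y) * g y by ring.
have x0 := cenorm_ge0 x; have y0 := cenorm_ge0 y; have xy0 := cenorm_ge0 (x - y).
have M1 : 1 <= 1 + cenorm x + cenorm y by lra.
have Mx : cabs (f x) <= c' * (1 + cenorm x + cenorm y) ^+ k'.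
  apply: le_trans (fG x) _; apply: ler_wpM2l => //.
  by rewrite lerXn2r ?nnegrE//; lra.
have My : cabs (g y) <= d' * (1 + cenorm x + cenorm y) ^+ l'.
  apply: le_trans (gG y) _; apply: ler_wpM2l => //.
  by rewrite lerXn2r ?nnegrE//; lra.
have := fP x y; have := gP x y; move: Mx My.
set M := 1 + cenorm x + cenorm y in M1 *; set D := cenorm (x - y) in xy0 * => Mx My gxy fxy.
apply: le_trans (cabsD _ _) _; rewrite !cabsM 2!mulrDl; apply: lerD.
  apply: (@le_trans _ _ ((c' * M ^+ k') * (d * M ^+ l * D))).
    by apply: ler_pM => //; exact: cabs_ge0.
  have -> : c' * M ^+ k' * (d * M ^+ l * D) = c' * d * M ^+ (k' + l) * D.
    by rewrite exprD; ring.
  apply: ler_wpM2r => //; apply: ler_wpM2l; first exact: mulr_ge0.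
  by apply: ler_weXn2l => //; exact: leq_addr.
apply: (@le_trans _ _ ((c * M ^+ k * D) * (d' * M ^+ l'))).
  by apply: ler_pM => //; exact: cabs_ge0.
have -> : c * M ^+ k * D * (d' * M ^+ l') = c * d' * M ^+ (k + l') * D.
  by rewrite exprD; ring.
apply: ler_wpM2r => //; apply: ler_wpM2l; first exact: mulr_ge0.
by apply: ler_weXn2l => //; exact: leq_addl.
Qed.

Lemma CllipC_sqr f : CllipC f -> CllipC (fun x => f x ^+ 2).
Proof. by move=> fL; exact: (CllipC_mul fL fL). Qed.

Lemma CllipC_sum I (r : seq I) (F : I -> 'rV[C]_n -> C) :
  (forall i, CllipC (F i)) -> CllipC (fun x => \sum_(i <- r) F i x).
Proof.
move=> FL; elim: r => [|i r IH].
  under [X in CllipC X]eq_fun do rewrite big_nil.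
  exact: CllipC_cst.
under [X in CllipC X]eq_fun do rewrite big_cons.
exact: CllipC_add.
Qed.

End LocallyLipschitzAlgebra.

(** * Complex random variables *)

Section RandomVariables.
Variables (R : realType) (S : sublinear_space R).
Local Notation C := R[i].
Local Notation Om := (Omega S).
Implicit Types (X Y : Om -> R) (Z W : Om -> C).

(** An isometric parametrization of complex rows by real ones: it transports
    the closure of random variables under real locally Lipschitz functions to
    functions of complex variables. *)
Definition complex_row n (x : 'rV[R]_(n + n)) : 'rV[C]_n :=
  \row_i (x ord0 (lshift n i) +i* x ord0 (rshift n i)).

Lemma cenorm_complex_row n (x : 'rV[R]_(n + n)) :
  cenorm (complex_row x) = enorm x.
Proof.
congr Num.sqrt; rewrite big_split_ord /= -big_split /=.
by apply: eq_bigr => i _; rewrite !mxE sqr_cabs.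
Qed.

Lemma complex_rowB n (x y : 'rV[R]_(n + n)) :
  complex_row (x - y) = complex_row x - complex_row y.
Proof. by apply/rowP => i; rewrite !mxE. Qed.

Lemma crv_CllipC n (f : 'rV[C]_n -> C) (Z : 'I_n -> Om -> C) :
  CllipC f -> (forall i, crv (Z i)) -> crv (fun w => f (\row_i Z i w)).
Proof.
move=> [c [k fP]] Zrv.
pose X (i : 'I_(n + n)) (w : Om) := match fintype.split i with
  | inl j => complex.Re (Z j w) | inr j => complex.Im (Z j w) end.
have Xrv i : rv (X i) by rewrite /X; case: (fintype.split i) => j; case: (Zrv j).
have XE w : complex_row (\row_i X i w) = \row_i Z i w.
  apply/rowP => i; rewrite !mxE /X (unsplitK (inl _ i)) (unsplitK (inr _ i)).
  by case: (Z i w).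
have fR (p : C -> R) : (forall z1 z2, p z1 - p z2 = p (z1 - z2)) ->
    (forall z, `|p z| <= cabs z) -> rv (fun w => p (f (\row_i Z i w))).
  move=> pB p_le; under [X in rv X]eq_fun do rewrite -XE.
  apply: (@rv_Cllip R S _ (fun x => p (f (complex_row x)))) => //.
  exists c, k => x y; rewrite pB; apply: le_trans (p_le _) _.
  by rewrite -!cenorm_complex_row complex_rowB.
split.
  by apply: fR; [move=> [? ?] [? ?] | exact: normRe_le_cabs].
by apply: fR; [move=> [? ?] [? ?] | exact: normIm_le_cabs].
Qed.

Lemma rv_opp X : rv X -> rv (fun w => - X w).
Proof.
by move=> Xrv; under [X in rv X]eq_fun do rewrite -mulN1r; exact: rv_scale.
Qed.

Lemma rv_sub X Y : rv X -> rv Y -> rv (fun w => X w - Y w).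
Proof. by move=> Xrv Yrv; apply: rv_add => //; exact: rv_opp. Qed.

Lemma crv_cst c : crv (fun _ : Om => c).
Proof. by split; exact: rv_cst. Qed.

Lemma crv_add Z W : crv Z -> crv W -> crv (fun w => Z w + W w).
Proof.
move=> [Z1 Z2] [W1 W2]; split.
  by under [X in rv X]eq_fun do rewrite raddfD; exact: rv_add.
by under [X in rv X]eq_fun do rewrite raddfD; exact: rv_add.
Qed.

Lemma crv_sub Z W : crv Z -> crv W -> crv (fun w => Z w - W w).
Proof.
move=> [Z1 Z2] [W1 W2]; split.
  by under [X in rv X]eq_fun do rewrite raddfB; exact: rv_sub.
by under [X in rv X]eq_fun do rewrite raddfB; exact: rv_sub.
Qed.

Lemma crv_mul Z W : crv Z -> crv W -> crv (fun w => Z w * W w).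
Proof.
move=> Zrv Wrv.
pose V (i : 'I_2) := if i == ord0 then Z else W.
have := @crv_CllipC 2 (fun x => x ord0 ord0 * x ord0 ord_max) V.
move/(_ (CllipC_mul (CllipC_coord _ ord0) (CllipC_coord _ ord_max))).
under [X in crv X]eq_fun do rewrite !mxE.
by apply=> i; rewrite /V; case: ifP.
Qed.

Lemma crv_sqr Z : crv Z -> crv (fun w => Z w ^+ 2).
Proof. by move=> Zrv; exact: crv_mul. Qed.

Lemma crv_conj Z : crv Z -> crv (fun w => (Z w)^*).
Proof.
move=> [Z1 Z2]; split.
  by under [X in rv X]eq_fun do rewrite Re_conj.
by under [X in rv X]eq_fun do rewrite Im_conj; exact: rv_opp.
Qed.

Lemma rv_mul X Y : rv X -> rv Y -> rv (fun w => X w * Y w).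
Proof.
move=> Xrv Yrv.
have [] : crv (fun w => (X w)%:C * (Y w)%:C).
  by apply: crv_mul; split => //; exact: rv_cst.
by under [X in rv X]eq_fun do rewrite /= mul0r subr0.
Qed.

Lemma rv_sqr_cabs Z : crv Z -> rv (fun w => cabs (Z w) ^+ 2).
Proof.
move=> [Z1 Z2]; under [X in rv X]eq_fun do rewrite sqr_cabs.
by apply: rv_add; exact: rv_mul.
Qed.

End RandomVariables.

(** * Sublinear expectations and the L2 norm *)

Section SublinearExpectation.
Variables (R : realType) (S : sublinear_space R).
Local Notation C := R[i].
Local Notation Om := (Omega S).
Implicit Types (X Y : Om -> R) (Z W : Om -> C).

Lemma eq_expect X Y : X =1 Y -> expect X = expect Y.
Proof. by move=> /funext ->. Qed.

Lemma expect_ge0 X : rv X -> (forall w, 0 <= X w) -> 0 <= expect X.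
Proof.
by move=> Xrv X0; rewrite -[leLHS](expect_cst S 0) expect_le//; exact: rv_cst.
Qed.

Lemma expect_opp_ge0 X : rv X -> 0 <= expect X + expect (fun w => - X w).
Proof.
move=> Xrv; apply: le_trans (expect_subadd Xrv (rv_opp Xrv)).
by under eq_expect do rewrite subrr; rewrite expect_cst.
Qed.

(** Sub-additivity bounds [expect (X + Y)] above by [expect X], and below by
    [expect X] since [X = (X + Y) - Y]. *)
Lemma expect_add_zero_mean X Y : rv X -> rv Y ->
  expect Y = 0 -> expect (fun w => - Y w) = 0 ->
  expect (fun w => X w + Y w) = expect X.
Proof.
move=> Xrv Yrv Y0 NY0; apply/le_anti/andP; split.
  by have := expect_subadd Xrv Yrv; rewrite Y0 addr0.
have := expect_subadd (rv_add Xrv Yrv) (rv_opp Yrv).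
by under eq_expect do rewrite addrK; rewrite NY0 addr0.
Qed.

(** With [c = expect X >= 0], this is the expectation of
    [2 * c * X <= X ^+ 2 + c ^+ 2]. *)
Lemma sqr_expect_le X : rv X -> 0 <= expect X ->
  expect X ^+ 2 <= expect (fun w => X w ^+ 2).
Proof.
move=> Xrv; set c := expect X => c0.
have X2rv : rv (fun w => X w ^+ 2) by exact: rv_mul.
have : expect (fun w => 2 * c * X w) <= expect (fun w => X w ^+ 2 + c ^+ 2).
  apply: expect_le => [||w]; [exact: rv_scale | by apply: rv_add => //; exact: rv_cst |].
  by have := sqr_ge0 (X w - c); lra.
rewrite expect_poshom ?mulr_ge0// expect_addcst// -/c; lra.
Qed.

Lemma L2norm_ge0 Z : 0 <= L2norm Z.
Proof. exact: sqrtr_ge0. Qed.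

Lemma sqr_L2norm Z : crv Z -> L2norm Z ^+ 2 = expect (fun w => cabs (Z w) ^+ 2).
Proof.
move=> Zrv; rewrite sqr_sqrtr// expect_ge0 => // [|w]; last exact: sqr_ge0.
exact: rv_sqr_cabs.
Qed.

Lemma L2normZ c Z : crv Z -> L2norm (fun w => c * Z w) = cabs c * L2norm Z.
Proof.
move=> Zrv; rewrite /L2norm; under eq_expect do rewrite cabsM exprMn.
rewrite expect_poshom ?sqr_ge0//; last exact: rv_sqr_cabs.
by rewrite sqrtrM ?sqr_ge0// sqrtr_sqr ger0_norm// cabs_ge0.
Qed.

Lemma L2normB Z W : L2norm (fun w => Z w - W w) = L2norm (fun w => W w - Z w).
Proof.
congr Num.sqrt; apply: eq_expect => w.
by rewrite -opprB !sqr_cabs !raddfN !sqrrN.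
Qed.

Lemma expect_Re_le_L2norm Z : crv Z ->
  expect (fun w => complex.Re (Z w)) <= L2norm Z.
Proof.
move=> Zrv; have [Z1 _] := Zrv.
have [E0|/ltW] := leP 0 (expect (fun w => complex.Re (Z w))); last first.
  by move=> /le_trans; apply; exact: L2norm_ge0.
rewrite -(@ler_pXn2r _ 2)// ?nnegrE ?L2norm_ge0// sqr_L2norm//.
apply: le_trans (sqr_expect_le Z1 E0) _.
apply: expect_le => [||w]; [exact: rv_mul | exact: rv_sqr_cabs |].
by rewrite sqr_cabs lerDl sqr_ge0.
Qed.

(** Minkowski's inequality without duality: for positive [p] and [q] one has
    [|z + w|^2 <= (1 + q / p) * |z|^2 + (1 + p / q) * |w|^2], whose right-hand
    side has expectation at most [(p + q) ^+ 2] when [p] and [q] dominate the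
    two norms.  Adding [e / 2] to each norm makes [p] and [q] positive even
    when a norm vanishes. *)
Lemma L2norm_triangle Z W : crv Z -> crv W ->
  L2norm (fun w => Z w + W w) <= L2norm Z + L2norm W.
Proof.
move=> Zrv Wrv; have ZWrv := crv_add Zrv Wrv.
have Z2 := rv_sqr_cabs Zrv; have W2 := rv_sqr_cabs Wrv.
apply/ler_addgt0Pr => e e0.
set p := L2norm Z + e / 2; set q := L2norm W + e / 2.
have z0 := L2norm_ge0 Z; have w0 := L2norm_ge0 W.
have p0 : 0 < p by rewrite /p; lra.
have q0 : 0 < q by rewrite /q; lra.
have -> : L2norm Z + L2norm W + e = p + q by rewrite /p /q; field.
have pq_ge0 : 0 <= p + q by lra.
rewrite -(@ler_pXn2r _ 2)// ?nnegrE ?L2norm_ge0// sqr_L2norm//.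
have qp0 : 0 <= 1 + q / p by rewrite addr_ge0// divr_ge0// ltW.
have pq0 : 0 <= 1 + p / q by rewrite addr_ge0// divr_ge0// ltW.
apply: (@le_trans _ _ (expect (fun w =>
    (1 + q / p) * cabs (Z w) ^+ 2 + (1 + p / q) * cabs (W w) ^+ 2))).
  apply: expect_le => [||w]; [exact: rv_sqr_cabs | by apply: rv_add; exact: rv_scale |].
  apply: (@le_trans _ _ ((cabs (Z w) + cabs (W w)) ^+ 2)).
    by rewrite lerXn2r ?nnegrE ?addr_ge0 ?cabs_ge0// cabsD.
  rewrite -subr_ge0.
  have -> : (1 + q / p) * cabs (Z w) ^+ 2 + (1 + p / q) * cabs (W w) ^+ 2 -
      (cabs (Z w) + cabs (W w)) ^+ 2 =
      (q * cabs (Z w) - p * cabs (W w)) ^+ 2 / (p * q).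
    by field; rewrite !gt_eqF.
  by rewrite divr_ge0 ?sqr_ge0// mulr_ge0 ?ltW.
apply: le_trans (expect_subadd (rv_scale _ Z2) (rv_scale _ W2)) _.
rewrite !expect_poshom// -!sqr_L2norm//.
have -> : (p + q) ^+ 2 = (1 + q / p) * p ^+ 2 + (1 + p / q) * q ^+ 2.
  by field; rewrite !gt_eqF.
apply: lerD; apply: ler_wpM2l => //.
  by rewrite lerXn2r ?nnegrE//; [exact: ltW | rewrite /p; lra].
by rewrite lerXn2r ?nnegrE//; [exact: ltW | rewrite /q; lra].
Qed.

End SublinearExpectation.

(** * The L2 completion *)

Section L2Completion.
Variables (R : realType) (S : sublinear_space R).
Local Notation C := R[i].
Local Notation Om := (Omega S).
Variables (B : R -> Om -> C) (t : R).
Hypothesis B_crv : forall s : R, 0 <= s -> crv (B s).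
Hypothesis t_ge0 : 0 <= t.
Implicit Types p q r : L2G B t.

Lemma crv_cylinder X : cylinder B t X -> crv X.
Proof.
case=> n [ts [f [ts0 fL ->]]]; apply: (crv_CllipC fL) => i.
by apply: B_crv; rewrite le_min ts0.
Qed.

Lemma crv_L2seq p n : crv (p n).
Proof. exact: crv_cylinder (L2seq_cylinder p n). Qed.

(** The norms of the differences form a Cauchy sequence, so that the limit
    defining the distance is genuine. *)
Lemma cvg_L2dist p q : cvgn (fun n => L2norm (fun w => p n w - q n w)).
Proof.
apply/cauchy_cvgP; apply: cauchy_exP => e e0.
have e20 : 0 < e / 2 by exact: divr_gt0.
have [N1 pN] := L2seq_cauchy p e20; have [N2 qN] := L2seq_cauchy q e20.
pose N := maxn N1 N2; exists (L2norm (fun w => p N w - q N w)).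
exists N => // m /= Nm; rewrite /ball /= ltr_norml.
have le_dist i j : L2norm (fun w => p i w - q i w) <=
    L2norm (fun w => p i w - p j w) + L2norm (fun w => p j w - q j w) +
    L2norm (fun w => q j w - q i w).
  have -> : (fun w => p i w - q i w) =
      fun w => (p i w - p j w) + (p j w - q j w) + (q j w - q i w).
    by apply/funext => w; ring.
  have hp k := crv_L2seq p k; have hq k := crv_L2seq q k.
  have pp := crv_sub (hp i) (hp j); have pq := crv_sub (hp j) (hq j).
  apply: le_trans (L2norm_triangle (crv_add pp pq) (crv_sub (hq j) (hq i))) _.
  by rewrite lerD2r; exact: L2norm_triangle.
have N1m : (N1 <= m)%N by apply: leq_trans Nm; exact: leq_maxl.
have N2m : (N2 <= m)%N by apply: leq_trans Nm; exact: leq_maxr.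
have := pN m N N1m (leq_maxl _ _); have := qN m N N2m (leq_maxr _ _).
have := le_dist m N; have := le_dist N m.
rewrite (L2normB (p N) (p m)) (L2normB (q N) (q m)) => *.
by apply/andP; split; lra.
Qed.

Lemma L2dist_triangle p q r : L2dist p r <= L2dist p q + L2dist q r.
Proof.
have pq := @cvg_L2dist p q; have qr := @cvg_L2dist q r.
rewrite /L2dist -limD//; apply: ler_lim; [exact: cvg_L2dist | exact: is_cvgD |].
apply: nearW => n /=; rewrite -[leRHS]/(_ + _).
have -> : (fun w => p n w - r n w) =
    fun w => (p n w - q n w) + (q n w - r n w) by apply/funext => w; ring.
by apply: L2norm_triangle; apply: crv_sub; exact: crv_L2seq.
Qed.

Lemma L2dist_zero X (hX : cylinder B t X) :
  L2dist (L2embed hX) (L2zero B t) = L2norm X.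
Proof.
rewrite /L2dist /=; under eq_fun do under [X in L2norm X]eq_fun do rewrite subr0.
exact: lim_cst.
Qed.

End L2Completion.

(** * Quadratic variation sums *)

Lemma partition_prefix (R : realType) (t : R) N pi k :
  is_partition t N pi -> (k <= N)%N -> is_partition (pi k) k pi.
Proof. by case=> pi0 _ lt_pi kN; split=> // j jk; exact/lt_pi/(leq_trans jk). Qed.

Section BrownianIncrements.
Variables (R : realType) (S : sublinear_space R).
Local Notation C := R[i].
Local Notation Om := (Omega S).
Variable B : R -> Om -> C.
Hypothesis B_GBM : complex_GBM B.

Lemma GBM_crv t : 0 <= t -> crv (B t).
Proof. by case: B_GBM => Brv _ _; exact: Brv. Qed.

Lemma expect_Re_increment (f : C -> C) t s : 0 <= t -> 0 <= s ->
  CllipC (fun x : 'rV[C]_1 => f (x ord0 ord0)) ->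
  expect (fun w => complex.Re (f (B (t + s) w - B t w))) =
  expect (fun w => complex.Re (f ((Num.sqrt s)%:C * B 1 w))).
Proof.
move=> t0 s0 fL; case: B_GBM => _ _ /(_ _ _ t0 s0)[_ /(_ _ fL)].
rewrite /vec1 => /(congr1 (@complex.Re R)) /= + _.
by under eq_expect do rewrite mxE; under [X in _ = X -> _]eq_expect do rewrite mxE.
Qed.

(** The scaling [B (t + s) - B t ~ sqrt s * B 1] turns moments of order two
    and four of an increment into multiples of [s] and [s ^+ 2]. *)
Lemma expect_Re_sqr_increment c t s : 0 <= t -> 0 <= s ->
  expect (fun w => complex.Re (c * (B (t + s) w - B t w) ^+ 2)) =
  s * expect (fun w => complex.Re (c * B 1 w ^+ 2)).
Proof.
move=> t0 s0; rewrite (expect_Re_increment (f := fun z => c * z ^+ 2))//; last first.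
  by apply: CllipC_mul; [exact: CllipC_cst | exact/CllipC_sqr/CllipC_coord].
have B1 := GBM_crv ler01.
rewrite -expect_poshom//; last by have [] := crv_mul (crv_cst S c) (crv_sqr B1).
apply: eq_expect => w.
rewrite exprMn -rmorphXn /= sqr_sqrtr// mulrCA.
by case: (c * _) => a b /=; rewrite mul0r subr0.
Qed.

Lemma expect_pow4_increment t s : 0 <= t -> 0 <= s ->
  expect (fun w => cabs ((B (t + s) w - B t w) ^+ 2) ^+ 2) =
  s ^+ 2 * expect (fun w => cabs (B 1 w ^+ 2) ^+ 2).
Proof.
move=> t0 s0.
have sqr_cabsE (z : C) : cabs z ^+ 2 = complex.Re (z * z^*).
  by rewrite sqr_cabs; case: z => a b /=; ring.
under eq_expect do rewrite sqr_cabsE.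
rewrite (expect_Re_increment (f := fun z => z ^+ 2 * (z ^+ 2)^*))//; last first.
  by apply: CllipC_mul; [|apply: CllipC_conj]; exact/CllipC_sqr/CllipC_coord.
have B1 := GBM_crv ler01.
rewrite -expect_poshom ?sqr_ge0//; last exact/rv_sqr_cabs/crv_sqr.
apply: eq_expect => w; rewrite -sqr_cabsE !cabsM.
rewrite /cabs /= expr0n addr0 sqrtr_sqr ger0_norm ?sqrtr_ge0//.
by have := sqr_sqrtr s0; set r := Num.sqrt s => <-; ring.
Qed.

Lemma crv_qv_sum t N pi : is_partition t N pi -> crv (qv_sum B N pi).
Proof.
move=> hpi; have /andP[h0 ht] := partition_bounds hpi (leq0n N).
exact: (crv_cylinder GBM_crv (le_trans h0 ht) (cylinder_qv_sum B hpi)).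
Qed.

(** The partial sum up to the last partition point is a function of the
    process at the earlier points, hence the last increment may be integrated
    first, with the partial sum frozen. *)
Lemma expect_qv_sum_last (psi : C -> C -> C) t k pi :
  is_partition t k.+1 pi ->
  (forall n (f g : 'rV[C]_n -> C), CllipC f -> CllipC g ->
     CllipC (fun x => psi (f x) (g x))) ->
  expect (fun w => complex.Re
    (psi (qv_sum B k pi w) (B (pi k.+1) w - B (pi k) w))) =
  expect (fun w => expect (fun w' => complex.Re
    (psi (qv_sum B k pi w) (B (pi k.+1) w' - B (pi k) w')))).
Proof.
move=> hpi psiL.
have hk := partition_prefix hpi (leqnSn k).
have /andP[pik0 _] := partition_bounds hpi (leqnSn k).
have dpi : 0 <= pi k.+1 - pi k by case: hpi => _ _ /(_ k (ltnSn k)); lra.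
have [_ _ /(_ _ _ pik0 dpi)[_ _]] := B_GBM.
rewrite subrKC.
move=> /(_ k.+1 (fun i => pi i)) indep_last.
pose past (x : 'rV[C]_(k.+1 + 1)) := \sum_(j < k)
  (x ord0 (lshift 1 (lift ord0 j)) +
   -1 * x ord0 (lshift 1 (widen_ord (leqnSn k) j))) ^+ 2.
have pastL : CllipC past.
  apply: CllipC_sum => j; apply/CllipC_sqr/CllipC_add; first exact: CllipC_coord.
  by apply: CllipC_mul; [exact: CllipC_cst | exact: CllipC_coord].
have lastL : CllipC (fun x : 'rV[C]_(k.+1 + 1) => x ord0 (rshift k.+1 ord0)).
  exact: CllipC_coord.
have pastE w (y : 'rV[C]_1) :
    past (row_mx (\row_(i < k.+1) B (pi i) w) y) = qv_sum B k pi w.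
  apply: eq_bigr => j _; rewrite !row_mxEl !mxE mulN1r.
  by rewrite /= /bump.
have ts_pi (i : 'I_k.+1) : 0 <= pi i <= pi k.
  exact: (partition_bounds hk (leq_ord i)).
have ts_mono (i j : 'I_k.+1) : (i <= j)%N -> pi i <= pi j.
  move=> ij; have hj := partition_prefix hk (leq_ord j).
  by case/andP: (partition_bounds hj ij).
have := indep_last ts_pi ts_mono _ (psiL _ _ _ pastL lastL).
move=> /(congr1 (@complex.Re R)) /= h.
under eq_expect => w do rewrite -(pastE w (const_mx (B (pi k.+1) w - B (pi k) w))).
under [RHS]eq_expect => w do under eq_expect => w' do
  rewrite -(pastE w (const_mx (B (pi k.+1) w' - B (pi k) w'))).
move: h; under eq_expect do rewrite row_mxEr mxE.
by under [X in _ = X -> _]eq_expect do under eq_expect do rewrite row_mxEr mxE.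
Qed.

(** Although the expectation is only sub-additive, it is additive here: once
    the past is frozen, the mean of the last term is a constant, which can be
    taken out. *)
Lemma expect_Re_qv_sum c t N pi : is_partition t N pi ->
  expect (fun w => complex.Re (c * qv_sum B N pi w)) =
  t * expect (fun w => complex.Re (c * B 1 w ^+ 2)).
Proof.
elim: N t pi => [|k IH] t pi hpi.
  under eq_expect do rewrite /qv_sum big_ord0 mulr0.
  by rewrite expect_cst; case: hpi => -> <- _; rewrite mul0r.
have hk := partition_prefix hpi (leqnSn k).
have /andP[pik0 _] := partition_bounds hpi (leqnSn k).
have [_ pit lt_pi] := hpi.
have dpi : 0 <= pi k.+1 - pi k by have := lt_pi k (ltnSn k); lra.
under eq_expect do rewrite /qv_sum big_ord_recr /= -/(qv_sum B k pi _).
rewrite (expect_qv_sum_last (psi := fun a d => c * (a + d ^+ 2)) hpi); last first.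
  move=> n f g fL gL; apply: CllipC_mul; first exact: CllipC_cst.
  by apply: CllipC_add => //; exact: CllipC_sqr.
have Brv s : 0 <= s -> crv (B s) by exact: GBM_crv.
have srv := crv_qv_sum hk.
have Drv : crv (fun w => B (pi k.+1) w - B (pi k) w).
  by apply: crv_sub; apply: Brv; lra.
set m := expect (fun w => complex.Re (c * B 1 w ^+ 2)) in IH *.
have step w : expect (fun w' => complex.Re
    (c * (qv_sum B k pi w + (B (pi k.+1) w' - B (pi k) w') ^+ 2))) =
    complex.Re (c * qv_sum B k pi w) + (pi k.+1 - pi k) * m.
  under eq_expect do rewrite mulrDr raddfD addrC.
  rewrite expect_addcst.
    by rewrite addrC; have := expect_Re_sqr_increment c pik0 dpi; rewrite subrKC => ->.
  by have [] := crv_mul (crv_cst S c) (crv_sqr Drv).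
under eq_expect do rewrite step.
rewrite expect_addcst; last by have [] := crv_mul (crv_cst S c) srv.
by rewrite (IH _ _ hk) -pit; ring.
Qed.

(** In the square of the modulus of the sum, the cross terms integrate to
    zero, and the diagonal ones are of second order in the mesh. *)
Lemma expect_sqr_qv_sum_le d t N pi :
  (forall c, expect (fun w => complex.Re (c * B 1 w ^+ 2)) = 0) ->
  is_partition t N pi -> (forall j, (j < N)%N -> pi j.+1 - pi j <= d) ->
  expect (fun w => cabs (qv_sum B N pi w) ^+ 2) <=
  d * t * expect (fun w => cabs (B 1 w ^+ 2) ^+ 2).
Proof.
move=> B1_0; elim: N t pi => [|k IH] t pi hpi le_d.
  under eq_expect do rewrite /qv_sum big_ord0 cabs0 expr0n.
  by rewrite expect_cst; case: hpi => -> <- _; rewrite mulr0 mul0r.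
have hk := partition_prefix hpi (leqnSn k).
have /andP[pik0 _] := partition_bounds hpi (leqnSn k).
have [_ pit lt_pi] := hpi.
have dpi : 0 <= pi k.+1 - pi k by have := lt_pi k (ltnSn k); lra.
have Brv s : 0 <= s -> crv (B s) by exact: GBM_crv.
have {}IH := IH _ _ hk (fun j jk => le_d j (ltnW jk)).
have srv := crv_qv_sum hk.
pose D w := B (pi k.+1) w - B (pi k) w.
have Drv : crv D by apply: crv_sub; apply: Brv; lra.
have D2rv := crv_sqr Drv.
(* The real part of [psi a b] is the cross term of [|a + b ^+ 2|^2]; putting
   the conjugate on the past makes it complex linear in the new square. *)
pose psi (a b : C) := 2 * a^* * b ^+ 2.
have crossrv : crv (fun w => psi (qv_sum B k pi w) (D w)).
  by apply: crv_mul => //; apply: crv_mul; [exact: crv_cst | exact: crv_conj].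
have cross0 : expect (fun w => complex.Re (psi (qv_sum B k pi w) (D w))) = 0.
  rewrite (expect_qv_sum_last (psi := psi) hpi); last first.
    move=> n f g fL gL; apply: CllipC_mul; last exact: CllipC_sqr.
    by apply: CllipC_mul; [exact: CllipC_cst | exact: CllipC_conj].
  rewrite -[RHS](expect_cst S 0); apply: eq_expect => w.
  have := expect_Re_sqr_increment (2 * (qv_sum B k pi w)^*) pik0 dpi.
  by rewrite subrKC B1_0 mulr0.
have sqrD (a b : C) : cabs (a + b ^+ 2) ^+ 2 =
    complex.Re (psi a b) + (cabs a ^+ 2 + cabs (b ^+ 2) ^+ 2).
  rewrite !sqr_cabs /psi; move: (b ^+ 2) => {}b.
  by case: a b => [a1 a2] [b1 b2] /=; ring.
under eq_expect do rewrite /qv_sum big_ord_recr /= -/(qv_sum B k pi _) sqrD.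
have rv1 := rv_sqr_cabs srv; have rv2 := rv_sqr_cabs D2rv.
apply: le_trans (expect_subadd _ (rv_add rv1 rv2)) _; first by case: crossrv.
rewrite cross0 add0r; apply: le_trans (expect_subadd rv1 rv2) _.
have := expect_pow4_increment pik0 dpi; rewrite subrKC => ->.
set K := expect (fun w => cabs (B 1 w ^+ 2) ^+ 2) in IH *.
have K0 : 0 <= K.
  rewrite /K; apply: expect_ge0 => [|w]; last exact: sqr_ge0.
  exact/rv_sqr_cabs/crv_sqr/Brv/ler01.
have : (pi k.+1 - pi k) ^+ 2 * K <= d * (pi k.+1 - pi k) * K.
  by apply: ler_wpM2r => //; rewrite expr2 ler_wpM2r// le_d.
by rewrite -pit; lra.
Qed.

(** With uniform partitions, the linear identity of [expect_Re_qv_sum]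
    transfers a vanishing quadratic variation to [B 1 ^+ 2]; the quadratic
    bound of [expect_sqr_qv_sum_le] goes the other way. *)
Lemma conformal_GBMP : conformal_GBM B <->
  forall c, expect (fun w => complex.Re (c * B 1 w ^+ 2)) = 0.
Proof.
have Brv s : 0 <= s -> crv (B s) by exact: GBM_crv.
have B1rv c : rv (fun w => complex.Re (c * B 1 w ^+ 2)).
  by have [] := crv_mul (crv_cst S c) (crv_sqr (Brv 1 ler01)).
split=> [[_ /(_ _ ler01)[q qP q0]] | B1_0].
  suff B1_le0 c : expect (fun w => complex.Re (c * B 1 w ^+ 2)) <= 0.
    move=> c; apply/le_anti/andP; split=> //.
    have := expect_opp_ge0 (B1rv c); have := B1_le0 (- c).
    under eq_expect do rewrite mulNr raddfN.
    lra.
  have c0 := cabs_ge0 c.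
  apply/ler_addgt0Pr => e e0; rewrite add0r.
  (* [cabs c + 1] absorbs the factor [cabs c] of the norm of [c * q], and does
     not vanish. *)
  have [|d d0 dP] := qP (e / (cabs c + 1)); first by rewrite divr_gt0//; lra.
  pose N := (Num.truncn (d^-1)).+1.
  have N0 : 0 < N%:R :> R by rewrite ltr0n.
  have Nd : N%:R^-1 < d.
    by rewrite -[ltRHS]invrK ltf_pV2 ?posrE ?invr_gt0// truncnS_gt.
  have hpi : is_partition 1 N (fun j => j%:R / N%:R : R).
    split=> [||j _]; [by rewrite mul0r | by rewrite divff// gt_eqF |].
    by rewrite ltr_pM2r ?invr_gt0// ltr_nat.
  have mesh j : (j < N)%N -> j.+1%:R / N%:R - j%:R / N%:R < d.
    by move=> _; rewrite -mulrBl -natrB// subSnn mul1r.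
  have srv := crv_qv_sum hpi.
  have le_e : L2norm (qv_sum B N (fun j => j%:R / N%:R)) <= e / (cabs c + 1).
    rewrite -(L2dist_zero (cylinder_qv_sum B hpi)).
    apply: le_trans (L2dist_triangle Brv ler01 _ q _) _.
    by rewrite q0 addr0 ltW// dP.
  rewrite -[leLHS]mul1r -(expect_Re_qv_sum c hpi).
  apply: le_trans (expect_Re_le_L2norm (crv_mul (crv_cst S c) srv)) _.
  rewrite L2normZ//; apply: le_trans (ler_wpM2l c0 le_e) _.
  rewrite mulrA ler_pdivrMr; last by lra.
  by rewrite mulrC; apply: ler_wpM2l; [exact: ltW | lra].
split=> // t t0; exists (L2zero B t); last first.
  by rewrite (L2dist_zero (cylinder0 B t)) L2norm0.
move=> e e0; set K := expect (fun w => cabs (B 1 w ^+ 2) ^+ 2).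
have K0 : 0 <= K.
  rewrite /K; apply: expect_ge0 => [|w]; last exact: sqr_ge0.
  exact/rv_sqr_cabs/crv_sqr/Brv/ler01.
have tK0 : 0 <= t * K by exact: mulr_ge0.
(* The mesh is chosen so that its product with [t * K] is less than
   [e ^+ 2]. *)
exists (e ^+ 2 / (t * K + 1)); first by rewrite divr_gt0 ?exprn_gt0//; lra.
move=> N pi hpi mesh; rewrite L2dist_zero.
rewrite -(@ltr_pXn2r _ 2)// ?nnegrE ?L2norm_ge0 ?(ltW e0)//.
rewrite sqr_L2norm; last exact: crv_qv_sum hpi.
apply: le_lt_trans (expect_sqr_qv_sum_le B1_0 hpi (fun j jN => ltW (mesh j jN))) _.
rewrite -/K -mulrA mulrAC ltr_pdivrMr; last by lra.
by rewrite ltr_pM2l ?exprn_gt0//; lra.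
Qed.

End BrownianIncrements.

(** * Quadratic forms and the function G *)

(** The trace-free forms [x ^+ 2 - y ^+ 2] and [2 * x * y] are the real and
    imaginary parts of the square of [x + i y], so that trace-free quadratic
    forms are exactly the real parts of the multiples of this square. *)
Lemma quad_rvec (R : realType) (A : 'M[R]_2) (z : R[i]) :
  (rvec z *m A *m (rvec z)^T) ord0 ord0 =
  \tr A / 2 * cabs z ^+ 2 + complex.Re
   (((A ord0 ord0 - A ord_max ord_max) / 2 -i*
     ((A ord0 ord_max + A ord_max ord0) / 2)) * z ^+ 2).
Proof.
rewrite /mxtrace !mxE !big_ord_recl !big_ord0 !mxE !big_ord_recl !big_ord0 !mxE /=.
have -> : lift ord0 ord0 = ord_max :> 'I_2 by apply/val_inj.
rewrite sqr_cabs; by case: z => x y /=; field.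
Qed.

Lemma sup_conformal_Sigma (R : realType) (lo hi : R) (A : 'M[R]_2) : lo <= hi ->
  sup [set \tr (A *m L) | L in conformal_Sigma lo hi] =
  \tr A * (if 0 <= \tr A then hi else lo).
Proof.
move=> lohi; set T := [set _ | _ in _]; set M := \tr A * _.
have TM : T M.
  rewrite /M; case: ifP => _; [exists hi%:M | exists lo%:M];
    rewrite ?mul_mx_scalar ?mxtraceZ 1?mulrC//; [exists hi | exists lo] => //=.
    by rewrite lohi lexx.
  by rewrite lohi lexx.
have ubM : ubound T M.
  move=> _ [_ [v /= /andP[lov vhi] <-] <-].
  rewrite mul_mx_scalar mxtraceZ mulrC /M; have [A0|A0] := leP 0 (\tr A).
    exact: ler_wpM2l.
  by rewrite ler_wnM2l// ltW.
apply/le_anti/andP; split; first by apply: ge_sup => //; exists M.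
by apply: ub_le_sup => //; exists M.
Qed.

Theorem theorem6p10 (R : realType) (S : sublinear_space R)
    (B : R -> Omega S -> R[i]) (hB : complex_GBM B) :
  conformal_GBM B <->
  exists lo hi : R, 0 <= lo <= hi /\
    forall A : 'M[R]_2, A^T = A ->
      Gfun B A =
      2^-1 * sup [set \tr (A *m L) | L in conformal_Sigma lo hi].
Proof.
have B1 := GBM_crv hB ler01.
have B1sqr c : rv (fun w => complex.Re (c * B 1 w ^+ 2)).
  by have [] := crv_mul (crv_cst S c) (crv_sqr B1).
have cabsB1 := rv_sqr_cabs B1.
apply: iff_trans (conformal_GBMP hB) _; split=> [B1_0 | [lo [hi [/andP[_ lohi] GE]]] c].
  pose up := expect (fun w => cabs (B 1 w) ^+ 2).
  pose dn := expect (fun w => - cabs (B 1 w) ^+ 2).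
  have up_dn : 0 <= up + dn by exact: expect_opp_ge0.
  have dn0 : dn <= 0.
    rewrite -(expect_cst S 0); apply: expect_le => [||w]; [exact: rv_opp | exact: rv_cst |].
    by rewrite oppr_le0 sqr_ge0.
  have lohi : - dn / 2 <= up / 2 by lra.
  exists (- dn / 2), (up / 2); split=> [|A _]; first by apply/andP; split=> //; lra.
  rewrite sup_conformal_Sigma// /Gfun; congr (_ * _).
  under eq_expect do rewrite quad_rvec.
  rewrite expect_add_zero_mean; [| exact: rv_scale | exact: B1sqr | exact: B1_0 |]; last first.
    by under eq_expect do rewrite -raddfN -mulNr; exact: B1_0.
  have [A0|A0] := leP 0 (\tr A).
    by rewrite expect_poshom// -/up; [ring | lra].
  under eq_expect do rewrite -mulrNN.
  by rewrite expect_poshom// -/dn; [ring | lra | exact: rv_opp].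
(* The trace-free matrix whose quadratic form is [Re (c * z ^+ 2)]. *)
pose A : 'M[R]_2 := \matrix_(i, j)
  if i == j then (if i == ord0 then complex.Re c else - complex.Re c)
  else - complex.Im c.
have At : A^T = A by apply/matrixP => i j; rewrite !mxE eq_sym; case: eqP => [->|].
have trA : \tr A = 0.
  by rewrite /mxtrace !big_ord_recl big_ord0 !mxE /= addr0 subrr.
have := GE A At; rewrite sup_conformal_Sigma// trA mul0r mulr0 /Gfun.
under eq_expect do rewrite quad_rvec trA 2!mul0r add0r.
move=> /eqP; rewrite mulf_eq0 invr_eq0 pnatr_eq0 /= => /eqP <-.
apply: eq_expect => w; congr (complex.Re (_ * _)).
by rewrite !mxE /=; case: c {GE At trA} @A => a b /=; congr (_ +i* _); field.
Qed.
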